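(* Let $G$ be a connected $d$-regular simple graph with $d\ge 3$ which is not $K_4$, $K_5$, or $K_{3,3}$. Then \[ 1-\frac{2}{d}<\frac{\mathscr{K}_{nb}(G)}{\mathscr{K}_e(G)}<1. \]
   Context: Kemeny's constant of an irreducible finite Markov chain with transition matrix $P$ whose eigenvalues (with multiplicity) are $1=\rho_1,\rho_2,\dots,\rho_N$ (with $1$ simple) is $\mathscr{K}(P)=\sum_{i=2}^{N}\frac{1}{1-\rho_i}$. Arcs of $G$: for each edge $\{u,v\}$ the two ordered pairs $(u,v),(v,u)$. $\mathscr{K}_e(G)$ is Kemeny's constant of the chain on arcs where from $(u,v)$ one moves to $(v,w)$ with probability $1/\deg(v)$ for each neighbor $w$ of $v$. $\mathscr{K}_{nb}(G)$ is Kemeny's constant of the non-backtracking chain on arcs where from $(u,v)$ one moves to $(v,w)$ with probability $1/(\deg(v)-1)$ for each neighbor $w\neq u$ of $v$. *)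

(* Defs.v *)
From HB Require Import structures.
From mathcomp Require Import all_boot all_order all_algebra all_field.
Set Implicit Arguments. Unset Strict Implicit. Unset Printing Implicit Defensive.
Import Order.TTheory GRing.Theory Num.Theory.
Local Open Scope ring_scope.

Definition simple_graph (T : finType) (e : rel T) : Prop :=
  symmetric e /\ irreflexive e.

Definition connected_graph (T : finType) (e : rel T) : Prop :=
  forall x y : T, connect e x y.

Definition deg (T : finType) (e : rel T) (v : T) : nat := #|[pred w | e v w]|.

Definition regular (T : finType) (e : rel T) (d : nat) : Prop :=
  forall v : T, deg e v = d.

Definition graph_iso (T U : finType) (e : rel T) (f : rel U) : Prop :=
  exists h : T -> U, bijective h /\ forall x y : T, f (h x) (h y) = e x y.

Definition Kn_rel (n : nat) : rel 'I_n := fun i j => i != j.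
Definition K33_rel : rel (bool * 'I_3)%type := fun x y => x.1 != y.1.

Definition arc (T : finType) (e : rel T) : finType :=
  {x : T * T | e x.1 x.2}.

Definition arc_mx (T : finType) (e : rel T) (p : arc e -> arc e -> algC)
  : 'M[algC]_#|arc e| :=
  \matrix_(i, j) p (enum_val i) (enum_val j).

Definition P_edge (T : finType) (e : rel T) : 'M[algC]_#|arc e| :=
  arc_mx (fun a b : arc e =>
    if (val a).2 == (val b).1 then (deg e (val a).2)%:R^-1 else 0).

Definition P_nb (T : finType) (e : rel T) : 'M[algC]_#|arc e| :=
  arc_mx (fun a b : arc e =>
    if ((val a).2 == (val b).1) && ((val b).2 != (val a).1)
    then ((deg e (val a).2)%:R - 1)^-1 else 0).

Definition eigenvalues (n : nat) (A : 'M[algC]_n) : seq algC :=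
  sval (closed_field_poly_normal (char_poly A)).

Lemma eigenvaluesP (n : nat) (A : 'M[algC]_n) :
  char_poly A = \prod_(z <- eigenvalues A) ('X - z%:P).
Proof.
rewrite /eigenvalues; case: closed_field_poly_normal => r /= Hr.
by rewrite {1}Hr (monicP (char_poly_monic A)) scale1r.
Qed.

(* K(P) = sum over eigenvalues rho_2..rho_N (i.e. all but one copy of 1) of 1/(1-rho) *)
Definition Kemeny (n : nat) (A : 'M[algC]_n) : algC :=
  \sum_(z <- rem 1 (eigenvalues A)) (1 - z)^-1.

Definition K_e (T : finType) (e : rel T) : algC := Kemeny (P_edge e).
Definition K_nb (T : finType) (e : rel T) : algC := Kemeny (P_nb e).

(* Main.v *)
Require Import Defs.
From HB Require Import structures.
From mathcomp Require Import all_boot all_order all_algebra all_field.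
From mathcomp Require Import ring zify.
Import Order.TTheory GRing.Theory Num.Theory.
Set Implicit Arguments. Unset Strict Implicit. Unset Printing Implicit Defensive.
Local Open Scope ring_scope.

(** Write [n] for the number of vertices, [l_i] for the adjacency eigenvalues and
    [S] for the sum of [1 / (d - l_i)] over [l_i <> d].  A block-determinant
    identity of Ihara-Bass type, applied to both arc chains, gives
      K_e  = n (d - 1) + d S,
      K_nb = n ((d - 1)^2 / d + 1) + (d - 2) S + 1 / (d - 2).
    The lower bound is then immediate, and the upper bound is equivalent to
      n / d + 1 / (d - 2) < 2 S.
    Convexity of [1 / x] and [tr A = 0] give [S >= (n - 1)^2 / (d n)], which is
    enough except for K4, K5, (n, d) = (5, 3), which the handshake lemma forbids,
    and (n, d) = (6, 3).  There a cubic minorant of [1 / (3 - x)] together with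
    [tr A^2 = 18] gives [S >= 3/2 + tr A^3 / 324], and K33 is the only
    triangle-free cubic graph on six vertices. *)

(* [path.arc] shadows the type of arcs. *)
Local Notation arc := Defs.arc.


(** * Determinants of [X - H T] through block matrices *)

(** Schur complement: subtracting [H] times the bottom row from the top row clears the upper right
    block. *)
Lemma det_sub_mulmx (R : comNzRingType) N n (X : 'M[R]_N) (H : 'M_(N, n)) (T : 'M_(n, N)) :
  \det (X - H *m T) = \det (block_mx X H T 1%:M).
Proof.
have -> : block_mx X H T 1%:M =
    block_mx (X - H *m T) H 0 1%:M *m block_mx 1%:M 0 T 1%:M.
  by rewrite mulmx_block !(mulmx1, mulmx0, mul1mx, mul0mx) ?addr0 !add0r subrK.
by rewrite det_mulmx det_ublock det_lblock !det1 !mulr1.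
Qed.

(** Scale the block rows of [X, H; T, 1] by [Y] and [c]. The upper left block becomes the scalar
    [c], and the lower left one [c T] is a multiple of it, so elimination needs no division. The
    factor [c ^+ n] is the price for this, and [c] may be zero. *)
Lemma det_sub_mulmx_swap (R : comNzRingType) N n (X Y : 'M[R]_N) (H : 'M_(N, n))
    (T : 'M_(n, N)) (c : R) : Y *m X = c%:M ->
  \det Y * \det (X - H *m T) * c ^+ n = c ^+ N * \det (c%:M - T *m Y *m H).
Proof.
move=> YX.
have -> : \det Y = \det (block_mx Y 0 0 (1%:M : 'M_n)).
  by rewrite det_lblock det1 mulr1.
have -> : c ^+ n = \det (block_mx (1%:M : 'M_N) 0 0 (c%:M : 'M_n)).
  by rewrite det_lblock det1 mul1r det_scalar.
rewrite det_sub_mulmx mulrC -!det_mulmx !mulmx_block.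
rewrite !(mulmx1, mulmx0, mul1mx, mul0mx, addr0, add0r) YX mul_scalar_mx.
have -> : block_mx c%:M (Y *m H) (c *: T) c%:M =
    block_mx 1%:M 0 T 1%:M *m block_mx c%:M (Y *m H) 0 (c%:M - T *m Y *m H).
  rewrite mulmx_block !(mulmx1, mulmx0, mul1mx, mul0mx, addr0, add0r).
  by rewrite mul_mx_scalar mulmxA addrC subrK.
by rewrite det_mulmx det_lblock det_ublock !det1 !mul1r det_scalar.
Qed.

(** * Diagonalization and sums over eigenvalues *)

(** The rows of [U] are left eigenvectors. Keeping [U] explicit lets matrices diagonalized by the
    same [U] be multiplied eigenvalue by eigenvalue. *)
Definition diagonalizes n (A U : 'M[algC]_n) (l : 'rV[algC]_n) : Prop :=
  U \in unitmx /\ A = invmx U *m diag_mx l *m U.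

Lemma symmetric_real_diagonalizes n (A : 'M[algC]_n) :
  (forall i j, A i j = A j i) -> (forall i j, A i j \is Num.real) ->
  exists U l, diagonalizes A U l /\ (forall i, l 0 i \is Num.real).
Proof.
move=> symA realA.
have hA : A \is hermsymmx.
  apply: realsym_hermsym; last by apply/mxOverP.
  apply/is_hermitianmxP; rewrite expr0 scale1r map_mx_id //.
  by apply/matrixP=> i j; rewrite mxE.
exists (spectralmx A), (spectral_diag A); split; last first.
  by move=> i; apply/mxOverP; apply: hermitian_spectral_diag_real.
split; first exact: spectral_unit.
by apply/orthomx_spectralP; apply: hermitian_normalmx.
Qed.

(** Polynomial coefficients [a] and [b] cover both a characteristic polynomial and the quadratic
    pencil that appears on the vertex side. *)
Lemma diagonalizes_det n (A U : 'M[algC]_n) l (a b : {poly algC}) :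
  diagonalizes A U l ->
  \det (a%:M - b *: map_mx polyC A) = \prod_i (a - b * (l 0 i)%:P).
Proof.
case=> uU ->; rewrite !map_mxM /= map_diag_mx.
have uV : map_mx polyC (invmx U) *m map_mx polyC U = 1%:M.
  by rewrite -map_mxM mulVmx // map_mx1.
have -> : a%:M - b *: (map_mx polyC (invmx U) *m diag_mx (map_mx polyC l)
     *m map_mx polyC U) =
  map_mx polyC (invmx U) *m diag_mx (\row_i (a - b * (l 0 i)%:P)) *m map_mx polyC U.
  have -> : diag_mx (\row_i (a - b * (l 0 i)%:P)) =
      a%:M - b *: diag_mx (map_mx polyC l).
    apply/matrixP=> i j; rewrite !mxE; case: eqP => [->|_] /=.
      by rewrite !mulr1n.
    by rewrite !mulr0n mulr0 subrr.
  rewrite mulmxBr mulmxBl mul_mx_scalar -scalemxAl uV -scalemxAr -scalemxAl.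
  by rewrite scalemx1.
rewrite !det_mulmx mulrAC -det_mulmx uV det1 mul1r det_diag.
by apply: eq_bigr => i _; rewrite mxE.
Qed.

Lemma diagonalizes_mxtrace n (A U : 'M[algC]_n) l :
  diagonalizes A U l -> \tr A = \sum_i l 0 i.
Proof. by case=> uU ->; rewrite mxtrace_mulC mulmxA mulmxV // mul1mx mxtrace_diag. Qed.

Lemma diagonalizes_mulmx n (A B U : 'M[algC]_n) l m :
  diagonalizes A U l -> diagonalizes B U m ->
  diagonalizes (A *m B) U (\row_i (l 0 i * m 0 i)).
Proof.
move=> [uU ->] [_ ->]; split=> //; rewrite !mulmxA mulmxK //.
rewrite -[invmx U *m _ *m diag_mx m]mulmxA; congr (_ *m _ *m _).
apply/matrixP=> i j; rewrite mul_diag_mx !mxE.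
by case: eqP => [->|_]; rewrite ?mulr1n // !mulr0n mulr0.
Qed.

Lemma diagonalizes_scalar n (A U : 'M[algC]_n) l c :
  diagonalizes A U l -> A = c%:M -> forall i, l 0 i = c.
Proof.
move=> [uU E] Ac i.
have : U *m A *m invmx U = c%:M.
  by rewrite Ac mul_mx_scalar -scalemxAl mulmxV // scalemx1.
rewrite E !mulmxA mulmxV // mul1mx mulmxK // => /matrixP/(_ i i).
by rewrite !mxE eqxx !mulr1n.
Qed.

Lemma diagonalizes_scale n (A U : 'M[algC]_n) l c :
  diagonalizes A U l -> diagonalizes (c *: A) U (c *: l).
Proof. by case=> uU ->; split=> //; rewrite linearZ /= -scalemxAr -scalemxAl. Qed.

Lemma diagonalizes_zero n : diagonalizes (0 : 'M[algC]_n) 1%:M 0.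
Proof. by split; rewrite ?unitmx1 // linear0 mulmx0 mul0mx. Qed.

Lemma diagonalizes_row n (A U : 'M[algC]_n) l i j :
  diagonalizes A U l -> \sum_k U i k * A k j = l 0 i * U i j.
Proof.
case=> uU E; have : U *m A = diag_mx l *m U by rewrite E !mulmxA mulmxV // mul1mx.
by move/matrixP/(_ i j); rewrite mul_diag_mx !mxE.
Qed.

Lemma quadratic_split (a b : algC) : exists r s, r + s = a /\ r * s = b.
Proof.
have h := sqrtCK (a ^+ 2 - 4 * b).
exists ((a + sqrtC (a ^+ 2 - 4 * b)) / 2), ((a - sqrtC (a ^+ 2 - 4 * b)) / 2).
by split; field: h.
Qed.

(* The term at the eigenvalue 1 is [0^-1 = 0]. *)
Lemma Kemeny_all_eigenvalues n (A : 'M[algC]_n) :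
  Kemeny A = \sum_(z <- eigenvalues A) (1 - z)^-1.
Proof.
rewrite /Kemeny; have [h|h] := boolP (1 \in eigenvalues A).
  by rewrite (big_rem _ h) /= subrr invr0 add0r.
by rewrite rem_id.
Qed.

(* [det_sub_mulmx_swap] with [X = x + J] and [Y = x - J], whose product is [x^2 - c^2],
   compares the multisets of roots of the characteristic polynomials. *)
Lemma sum_eigenvalues_sub n N (H : 'M[algC]_(N, n)) (T : 'M_(n, N)) (J : 'M_N) (b c : algC)
    (UA : 'M_n) UJ l ep (f : algC -> algC) r s :
  diagonalizes (T *m H) UA l -> diagonalizes J UJ ep ->
  J *m J = (c ^+ 2)%:M -> T *m J *m H = b%:M ->
  (forall i, r i + s i = l 0 i) -> (forall i, r i * s i = b - c ^+ 2) ->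
  \sum_(z <- eigenvalues (H *m T - J)) f z + n%:R * (f c + f (- c)) =
  \sum_i f (- ep 0 i) + \sum_i (f (r i) + f (s i)).
Proof.
move=> dA dJ JJ TJH rs1 rs2.
have ep2 i : ep 0 i ^+ 2 = c ^+ 2.
  by have := diagonalizes_scalar (diagonalizes_mulmx dJ dJ) JJ i; rewrite mxE.
pose XX := 'X%:M + map_mx polyC J; pose YY := 'X%:M - map_mx polyC J.
have YX : YY *m XX = ('X ^+ 2 - (c ^+ 2)%:P)%:M.
  rewrite /YY /XX mulmxDr !mulmxBl -!map_mxM JJ map_scalar_mx.
  rewrite !mul_mx_scalar !mul_scalar_mx addrA subrK scale_scalar_mx.
  by rewrite -raddfB -expr2.
have eqn := det_sub_mulmx_swap (map_mx polyC H) (map_mx polyC T) YX.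
have dY : \det YY = \prod_i ('X - (ep 0 i)%:P).
  rewrite /YY -[map_mx _ _]scale1r (diagonalizes_det _ _ dJ).
  by apply: eq_bigr => i _; rewrite mul1r.
have dB : \det (XX - map_mx polyC H *m map_mx polyC T) = char_poly (H *m T - J).
  by rewrite /char_poly /char_poly_mx map_mxB map_mxM opprB addrA.
(* Since [T Y H = 'X (T H) - b], each eigenvalue [l] of [T H] contributes the factor
   ['X^2 - l 'X + (b - c^2)], whose roots are [r] and [s]. *)
have dR : \det (('X ^+ 2 - (c ^+ 2)%:P)%:M - map_mx polyC T *m YY *m map_mx polyC H) =
    \prod_i (('X - (r i)%:P) * ('X - (s i)%:P)).
  rewrite /YY mulmxBr mulmxBl mul_mx_scalar -scalemxAl -!map_mxM TJH map_scalar_mx.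
  rewrite opprB addrCA addrA -raddfD (diagonalizes_det _ _ dA).
  apply: eq_bigr => i _; rewrite -rs1.
  have := congr1 polyC (rs2 i); rewrite polyCM polyCB polyCD => E.
  ring: E.
have cE : 'X ^+ 2 - (c ^+ 2)%:P = ('X - c%:P) * ('X - (- c)%:P) :> {poly algC}.
  by rewrite polyCN rmorphXn /=; ring.
(* Every [ep] squares to [c^2], so [det Y] divides this power and its cofactor has the roots
   [- ep]. *)
have cN : ('X ^+ 2 - (c ^+ 2)%:P) ^+ N = \det YY * \prod_i ('X - (- ep 0 i)%:P).
  rewrite dY -big_split /= -[N in _ ^+ N]card_ord -prodr_const.
  by apply: eq_bigr => i _; rewrite -(ep2 i) polyCN rmorphXn /=; ring.
have Yn0 : \det YY != 0 by rewrite dY; apply/prodf_neq0 => i _; rewrite polyXsubC_eq0.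
move: eqn; rewrite cN dR dB -!mulrA => /(mulfI Yn0); rewrite eigenvaluesP cE => eqn.
(* The factor [('X^2 - c^2)^n] stays on the side of the eigenvalues, as [n] copies of [c] and of
   [- c], so that no multiset has to be subtracted. *)
pose L := eigenvalues (H *m T - J) ++ (nseq n c ++ nseq n (- c)).
pose M := [seq - ep 0 i | i <- enum 'I_N] ++
          ([seq r i | i <- enum 'I_n] ++ [seq s i | i <- enum 'I_n]).
have pe : perm_eq L M.
  apply: prod_XsubC_eq; rewrite !big_cat !big_map -!big_enum /= !big_enum /=.
  rewrite -big_split /= -eqn exprMn; congr (_ * (_ * _));
  by rewrite big_nseq -Monoid.iteropE.
have := perm_big (op := +%R) (x := 0) _ pe (P := xpredT) (F := f).
rewrite !big_cat !big_map -!big_enum /= !big_enum /= -big_split /= => <-.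
by rewrite !big_nseq; congr (_ + _); rewrite !iter_addr_0 mulrDr !mulr_natl.
Qed.


(** * Incidence and reversal matrices of the arcs *)

Definition adj (T : finType) (e : rel T) : 'M[algC]_#|T| :=
  \matrix_(i, j) (e (enum_val i) (enum_val j))%:R.

(** Together with [tails] this factors the successor relation on arcs through the vertices, which
    reduces spectra on arcs to the adjacency spectrum. *)
Definition heads (T : finType) (e : rel T) : 'M[algC]_(#|arc e|, #|T|) :=
  \matrix_(i, v) ((val (enum_val i)).2 == enum_val v)%:R.

Definition tails (T : finType) (e : rel T) : 'M[algC]_(#|T|, #|arc e|) :=
  \matrix_(v, i) ((val (enum_val i)).1 == enum_val v)%:R.

Definition reversal (T : finType) (e : rel T) : 'M[algC]_#|arc e| :=
  \matrix_(i, j) (val (enum_val j) == ((val (enum_val i)).2, (val (enum_val i)).1))%:R.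

Lemma sum_enum_val (R : nmodType) (T : finType) (F : T -> R) :
  \sum_(k < #|T|) F (enum_val k) = \sum_x F x.
Proof. by rewrite -big_enum_val. Qed.

Lemma sum_delta (R : pzSemiRingType) (T : finType) (c : T) (F : T -> R) :
  \sum_x (x == c)%:R * F x = F c.
Proof.
rewrite (bigD1 c) //= eqxx mul1r big1 ?addr0 // => x /negPf ->.
by rewrite mul0r.
Qed.

Lemma sum_delta_enum_val (R : pzSemiRingType) (T : finType) (c : T) (F : T -> R) :
  \sum_(k < #|T|) (enum_val k == c)%:R * F (enum_val k) = F c.
Proof. by rewrite (sum_enum_val (fun x => (x == c)%:R * F x)) sum_delta. Qed.

Lemma sum_arc (R : pzSemiRingType) (T : finType) (e : rel T) (F : T -> T -> R) :
  \sum_(k < #|arc e|) F (val (enum_val k)).1 (val (enum_val k)).2 =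
  \sum_x \sum_y (e x y)%:R * F x y.
Proof.
rewrite (sum_enum_val (fun a : arc e => F (val a).1 (val a).2)).
rewrite pair_big /= (bigID (fun p => e p.1 p.2)) /= [X in _ + X]big1 ?addr0; last first.
  by move=> p /negPf ->; rewrite mul0r.
under [RHS]eq_bigr => p ep do rewrite ep mul1r.
(* The partial inverse [insubd] of [val] needs a default arc, so a graph without arcs is treated
   apart. *)
have [p0|nop] := pickP (fun p : T * T => e p.1 p.2); last first.
  rewrite [RHS]big_pred0 // big1 // => -[p ep] _.
  by have := nop p; rewrite ep.
move=> ep0; rewrite (reindex_onto val (insubd (exist _ p0 ep0 : arc e))) /=.
  apply: eq_bigl => -[p ep] /=; rewrite ep /=.
  by apply/esym/eqP/val_inj; rewrite val_insubd ep.
by move=> p ep; rewrite val_insubd ep.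
Qed.

Lemma sum_adj_row (T : finType) (e : rel T) (x : T) :
  \sum_y (e x y)%:R = (deg e x)%:R :> algC.
Proof. by rewrite -natr_sum /deg -sum1_card [in RHS]big_mkcond. Qed.

Lemma card_arc_regular (T : finType) (e : rel T) d :
  regular e d -> #|arc e|%:R = #|T|%:R * d%:R :> algC.
Proof.
move=> reg; have := sum_arc e (fun _ _ => 1 : algC).
rewrite sumr_const card_ord => ->.
transitivity (\sum_(x : T) (d%:R : algC)); last by rewrite sumr_const mulr_natl.
apply: eq_bigr => x _; rewrite -(reg x) -sum_adj_row.
by apply: eq_bigr => y _; rewrite mulr1.
Qed.

Lemma heads_tails (T : finType) (e : rel T) i j :
  (heads e *m tails e) i j = ((val (enum_val i)).2 == (val (enum_val j)).1)%:R.
Proof.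
rewrite mxE -[RHS](sum_delta_enum_val (val (enum_val i)).2
  (fun v => (v == (val (enum_val j)).1)%:R)).
by apply: eq_bigr => k _; rewrite !mxE ![_ == enum_val k]eq_sym.
Qed.

Lemma tails_heads (T : finType) (e : rel T) : tails e *m heads e = adj e.
Proof.
apply/matrixP => u v; rewrite !mxE.
under eq_bigr => k _ do rewrite !mxE.
rewrite (sum_arc e (fun x y => (x == enum_val u)%:R * (y == enum_val v)%:R)).
transitivity (\sum_x (x == enum_val u)%:R *
    \sum_y (y == enum_val v)%:R * (e x y)%:R : algC); last by rewrite !sum_delta.
apply: eq_bigr => x _; rewrite mulr_sumr; apply: eq_bigr => y _.
by rewrite mulrC mulrA.
Qed.

Lemma tails_trtails (T : finType) (e : rel T) d :
  regular e d -> tails e *m (tails e)^T = (d%:R)%:M.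
Proof.
move=> reg; apply/matrixP => u v; rewrite !mxE.
under eq_bigr => k _ do rewrite !mxE.
rewrite (sum_arc e (fun x y => (x == enum_val u)%:R * (x == enum_val v)%:R)).
transitivity (\sum_x (x == enum_val u)%:R *
    ((x == enum_val v)%:R * d%:R) : algC).
  apply: eq_bigr => x _; rewrite -(reg x) -sum_adj_row !mulr_sumr.
  by apply: eq_bigr => y _; rewrite [LHS]mulrC mulrA.
by rewrite sum_delta (inj_eq enum_val_inj) mulr_natl.
Qed.

Definition arc_rev (T : finType) (e : rel T) (sym : symmetric e) (a : arc e) : arc e :=
  exist _ ((val a).2, (val a).1) (etrans (sym _ _) (valP a)).

Lemma arc_revK (T : finType) (e : rel T) (sym : symmetric e) : involutive (arc_rev sym).
Proof. by case=> -[x y] exy; apply: val_inj. Qed.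

Lemma reversalE (T : finType) (e : rel T) (sym : symmetric e) i j :
  reversal e i j = (enum_val j == arc_rev sym (enum_val i))%:R.
Proof. by rewrite mxE -val_eqE. Qed.

Lemma reversal_sym (T : finType) (e : rel T) (sym : symmetric e) i j :
  reversal e i j = reversal e j i.
Proof.
rewrite !(reversalE sym) -[X in X == _](arc_revK sym) (inj_eq (inv_inj (arc_revK sym))).
by rewrite eq_sym.
Qed.

Lemma reversal_mul (T : finType) (e : rel T) (sym : symmetric e) :
  reversal e *m reversal e = 1%:M.
Proof.
apply/matrixP => i j; rewrite !mxE.
transitivity (\sum_(k < #|arc e|) (enum_val k == arc_rev sym (enum_val i))%:R *
    (enum_val j == arc_rev sym (enum_val k))%:R : algC).
  by apply: eq_bigr => k _; rewrite !(reversalE sym).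
rewrite (sum_delta_enum_val _ (fun a => (enum_val j == arc_rev sym a)%:R)).
by rewrite arc_revK (inj_eq enum_val_inj) eq_sym.
Qed.

Lemma reversal_heads (T : finType) (e : rel T) (sym : symmetric e) :
  reversal e *m heads e = (tails e)^T.
Proof.
apply/matrixP => i v; rewrite !mxE.
transitivity (\sum_(k < #|arc e|) (enum_val k == arc_rev sym (enum_val i))%:R *
    ((val (enum_val k)).2 == enum_val v)%:R : algC).
  by apply: eq_bigr => k _; rewrite (reversalE sym) !mxE.
by rewrite (sum_delta_enum_val _ (fun a : arc e => ((val a).2 == enum_val v)%:R)).
Qed.

(** An arc equal to its reverse would be a loop. Consequently the eigenvalues 1 and -1 of the
    reversal balance out. *)
Lemma reversal_mxtrace (T : finType) (e : rel T) : irreflexive e -> \tr (reversal e) = 0.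
Proof.
move=> irr; apply: big1 => i _; rewrite mxE.
case: (enum_val i) => -[x y] /= exy; case: eqP => //= -[yx _].
by move: exy; rewrite yx irr.
Qed.

Lemma P_edgeE (T : finType) (e : rel T) d :
  regular e d -> P_edge e = (d%:R^-1 *: heads e) *m tails e.
Proof.
move=> reg; apply/matrixP => i j; rewrite -scalemxAl mxE [RHS]mxE heads_tails reg.
by case: eqP; rewrite ?mulr1 ?mulr0.
Qed.

(** Among the arcs leaving the head of a given arc, its reverse is the only forbidden
    continuation. *)
Lemma P_nbE (T : finType) (e : rel T) d :
  regular e d -> P_nb e =
  ((d%:R - 1)^-1 *: heads e) *m tails e - (d%:R - 1)^-1 *: reversal e.
Proof.
move=> reg; apply/matrixP => i j; rewrite -scalemxAl -scalerBr mxE [RHS]mxE reg.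
have -> : (heads e *m tails e - reversal e) i j =
    (heads e *m tails e) i j - reversal e i j by rewrite !mxE.
rewrite heads_tails mxE.
case: (enum_val i) => -[x y] exy; case: (enum_val j) => -[u v] euv /=.
rewrite xpair_eqE (eq_sym u y); case: eqP => _ /=; last by rewrite subrr mulr0.
by case: eqP => _ /=; rewrite ?subrr ?subr0 ?mulr0 ?mulr1.
Qed.


(** * Kemeny's constants of the two arc chains *)

(** This is the case [J = 0], [b = c = 0]: the roots attached to [l] are [l / d] and 0. At [l = d]
    both sides use the default value [0^-1 = 0]. *)
Lemma K_e_regular (T : finType) (e : rel T) d U l :
  regular e d -> (0 < d)%N -> diagonalizes (adj e) U l ->
  K_e e = #|T|%:R * (d%:R - 1) + d%:R * \sum_i (d%:R - l 0 i)^-1.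
Proof.
move=> reg d0 dA; rewrite /K_e Kemeny_all_eigenvalues (P_edgeE reg).
have dn0 : d%:R != 0 :> algC by rewrite pnatr_eq0 -lt0n.
have dA' : diagonalizes (tails e *m (d%:R^-1 *: heads e)) U (d%:R^-1 *: l).
  by rewrite -scalemxAr tails_heads; apply: diagonalizes_scale.
have JJ : (0 : 'M[algC]_#|arc e|) *m 0 = (0 ^+ 2)%:M.
  by rewrite mul0mx expr0n -scalemx1 scale0r.
have TJH : tails e *m 0 *m (d%:R^-1 *: heads e) = 0%:M.
  by rewrite mulmx0 mul0mx -scalemx1 scale0r.
have rs2 (i : 'I_#|T|) : (d%:R^-1 *: l) 0 i * 0 = 0 - 0 ^+ 2.
  by rewrite mulr0 expr0n subr0.
have := sum_eigenvalues_sub (fun z => (1 - z)^-1) dA' (diagonalizes_zero _)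
  JJ TJH (fun i => addr0 _) rs2.
rewrite !(oppr0, addr0) invr1 => E; apply: (addIr (#|T|%:R * (1 + 1))); rewrite E.
rewrite (eq_bigr (fun=> 1)); last by move=> i _; rewrite mxE oppr0 subr0 invr1.
rewrite big_split /= !sumr_const !card_ord (card_arc_regular reg).
have -> : \sum_i (1 - (d%:R^-1 *: l) 0 i)^-1 = d%:R * \sum_i (d%:R - l 0 i)^-1.
  rewrite mulr_sumr; apply: eq_bigr => i _; rewrite mxE.
  have -> : 1 - d%:R^-1 * l 0 i = d%:R^-1 * (d%:R - l 0 i) by rewrite mulrBr mulVf.
  by rewrite invfM invrK.
by ring.
Qed.

(* At [t = q + 1] one of the roots is 1 and its inverse is the junk value 0; the last
   term corrects for that. *)
Lemma inv_quadratic_roots (q r s t : algC) : q != 0 -> q != 1 ->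
  r + s = q^-1 * t -> r * s = q^-1 ->
  (1 - r)^-1 + (1 - s)^-1 =
  1 + (q - 1) * (q + 1 - t)^-1 + (t == q + 1)%:R * (q - 1)^-1.
Proof.
move=> q0 q1 rs1 rs2.
have q1' : q - 1 != 0 by rewrite subr_eq0.
have prod : q * ((1 - r) * (1 - s)) = q + 1 - t.
  have -> : q * ((1 - r) * (1 - s)) = q * (1 - (r + s) + r * s) by ring.
  by rewrite rs1 rs2; field.
have [tE|tn] := eqVneq t (q + 1); last first.
  have /eqP tn' : q + 1 - t != 0 by rewrite subr_eq0 eq_sym.
  rewrite mul0r addr0.
  have r1 : 1 - r != 0 by apply/eqP=> h; apply: tn'; rewrite -prod h mul0r mulr0.
  have s1 : 1 - s != 0 by apply/eqP=> h; apply: tn'; rewrite -prod h !mulr0.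
  have -> : (1 - r)^-1 + (1 - s)^-1 = (2 - (r + s)) / ((1 - r) * (1 - s)).
    by field; rewrite ?r1 ?s1.
  have -> : (1 - r) * (1 - s) = q^-1 * (q + 1 - t) by rewrite -prod mulKf.
  by rewrite rs1; field; rewrite ?q0 ?andbT; apply/eqP.
rewrite mul1r tE subrr invr0 mulr0 addr0.
have rs0 : (1 - r) * (1 - s) = 0.
  by apply: (mulfI q0); rewrite prod tE subrr mulr0.
(* One of the roots is 1, hence the other is [q^-1], and [(1 - q^-1)^-1 = 1 + (q - 1)^-1]. *)
wlog: r s rs1 rs2 prod rs0 / 1 - r = 0.
  move=> W; move/eqP: (rs0); rewrite mulf_eq0 => /orP[] /eqP h; first exact: W.
  rewrite addrC; apply: W => //; first by rewrite addrC.
  - by rewrite mulrC.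
  - by rewrite [X in _ * X]mulrC.
  by rewrite mulrC.
move=> h; have r1 : r = 1 by apply/eqP; rewrite eq_sym -subr_eq0 h.
by rewrite h invr0 add0r -[s]mul1r -[X in X * s]r1 rs2; field; rewrite ?q0 ?q1'.
Qed.

(** With [q = d - 1] and [J = q^-1 R], where [R] is the reversal, one has [c = q^-1] and
    [b = d / q^2], so each [l] yields the roots of [z^2 - (l / q) z + 1 / q]. The last summand comes
    from [l = d], where one root is 1. *)
Lemma K_nb_regular (T : finType) (e : rel T) d U l :
  simple_graph e -> regular e d -> (2 < d)%N -> diagonalizes (adj e) U l ->
  K_nb e = #|T|%:R * ((d%:R - 1) ^+ 2 / d%:R + 1) +
    (d%:R - 2) * \sum_i (d%:R - l 0 i)^-1 +
    (\sum_i (l 0 i == d%:R)%:R) / (d%:R - 2).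
Proof.
move=> [sym irr] reg d3 dA; rewrite /K_nb Kemeny_all_eigenvalues (P_nbE reg).
have dn0 : d%:R != 0 :> algC by rewrite pnatr_eq0 -lt0n (ltn_trans _ d3).
have d2 : d%:R - 2 != 0 :> algC.
  by rewrite subr_eq0 eqr_nat; case: d d3 {reg dA dn0} => [|[|[|]]].
set q : algC := d%:R - 1.
have dE : d%:R = q + 1 by rewrite subrK.
have d2E : d%:R - 2 = q - 1 by rewrite dE; ring.
have q0 : q != 0.
  by rewrite subr_eq0 (eqr_nat _ d 1); case: d d3 {reg dA dn0 d2 q dE d2E} => [|[|]].
have q1 : q != 1 by rewrite -subr_eq0 -d2E.
have q1' : q - 1 != 0 by rewrite -d2E.
have q1'' : q + 1 != 0 by rewrite -dE.
have q2 : q ^+ 2 - 1 != 0 by rewrite subr_sqr_1 mulf_neq0.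
have realR i j : reversal e i j \is Num.real by rewrite mxE realn.
have [UR [ep [dR _]]] := symmetric_real_diagonalizes (reversal_sym sym) realR.
have ep2 i : ep 0 i ^+ 2 = 1.
  have := diagonalizes_scalar (diagonalizes_mulmx dR dR) (reversal_mul sym) i.
  by rewrite mxE.
have ep0 : \sum_i ep 0 i = 0.
  by rewrite -(diagonalizes_mxtrace dR) reversal_mxtrace.
have dA' : diagonalizes (tails e *m (q^-1 *: heads e)) U (q^-1 *: l).
  by rewrite -scalemxAr tails_heads; apply: diagonalizes_scale.
have /fin_all_exists [r] := fun i => quadratic_split ((q^-1 *: l) 0 i) q^-1.
case/fin_all_exists => s rs.
have JJ : (q^-1 *: reversal e) *m (q^-1 *: reversal e) = (q^-1 ^+ 2)%:M.
  by rewrite -scalemxAr -scalemxAl reversal_mul // scalerA scalemx1.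
have TJH : tails e *m (q^-1 *: reversal e) *m (q^-1 *: heads e) = (d%:R * q^-1 ^+ 2)%:M.
  rewrite -mulmxA -[_ *m (q^-1 *: heads e)]scalemxAl -!scalemxAr reversal_heads //.
  by rewrite scalerA (tails_trtails reg) scale_scalar_mx mulrC.
have rs2 i : r i * s i = d%:R * q^-1 ^+ 2 - q^-1 ^+ 2 by rewrite (proj2 (rs i)) dE; field.
have := sum_eigenvalues_sub (fun z => (1 - z)^-1) dA' (diagonalizes_scale q^-1 dR)
  JJ TJH (fun i => (proj1 (rs i))) rs2.
move=> E; apply: (addIr (#|T|%:R * ((1 - q^-1)^-1 + (1 - - q^-1)^-1))); rewrite E {E}.
have -> : \sum_i (1 - - (q^-1 *: ep) 0 i)^-1 = #|T|%:R * d%:R * q ^+ 2 / (q ^+ 2 - 1).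
  (* As [ep] is 1 or -1, the inverse of [1 + ep / q] is affine in [ep], and the linear part vanishes
     with the trace of the reversal. *)
  transitivity (\sum_i (q ^+ 2 / (q ^+ 2 - 1) - q / (q ^+ 2 - 1) * ep 0 i)).
    apply: eq_bigr => i _; rewrite mxE opprK.
    have /eqP := ep2 i; rewrite sqrf_eq1 => /orP[] /eqP ->.
      by field; rewrite ?q0 ?q1' ?q2 ?q1''.
    by field; rewrite ?q0 ?q1' ?q2 ?q1''.
  rewrite sumrB -[X in _ - X]mulr_sumr ep0 mulr0 subr0 sumr_const card_ord -[LHS]mulr_natl.
  by rewrite (card_arc_regular reg) !mulrA.
have -> : \sum_i ((1 - r i)^-1 + (1 - s i)^-1) =
    \sum_i (1 + (q - 1) * (q + 1 - l 0 i)^-1 + (l 0 i == q + 1)%:R * (q - 1)^-1).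
  apply: eq_bigr => i _; apply: inv_quadratic_roots => //; last exact: (proj2 (rs i)).
  by rewrite (proj1 (rs i)) mxE.
rewrite !big_split /= sumr_const card_ord -mulr_sumr -mulr_suml d2E dE.
by field; rewrite ?q0 ?q1' ?q2 ?q1''.
Qed.


(** * Spectrum of the adjacency matrix *)

(** Expand the square: the two diagonal terms give [d] each and the two cross terms [- s t] each.
    The sign [s] serves both ends of the spectrum, 1 for the upper bound and -1 for the lower
    one. *)
Lemma dirichlet_form (T : finType) (e : rel T) d (v : T -> algC) (t s : algC) :
  symmetric e -> regular e d -> s \is Num.real -> s ^+ 2 = 1 ->
  (forall y, \sum_x v x * (e x y)%:R = t * v y) ->
  \sum_x \sum_y (e x y)%:R * `|v x - s * v y| ^+ 2 =
  2 * (d%:R - s * t) * \sum_x `|v x| ^+ 2.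
Proof.
move=> sym reg sr s2 ev.
pose S := \sum_x `|v x| ^+ 2.
have S1 : \sum_x \sum_y (e x y)%:R * `|v x| ^+ 2 = d%:R * S.
  rewrite mulr_sumr; apply: eq_bigr => x _.
  by rewrite -mulr_suml sum_adj_row reg.
have S2 : \sum_x \sum_y (e x y)%:R * `|v y| ^+ 2 = d%:R * S.
  rewrite exchange_big /= -S1; apply: eq_bigr => x _; apply: eq_bigr => y _.
  by rewrite sym.
have S3 : \sum_x \sum_y (e x y)%:R * (v x * (v y)^*) = t * S.
  rewrite exchange_big mulr_sumr; apply: eq_bigr => y _ /=.
  rewrite normCK mulrA -ev mulr_suml; apply: eq_bigr => x _; ring.
have S4 : \sum_x \sum_y (e x y)%:R * (v y * (v x)^*) = t * S.
  rewrite -S3 exchange_big /=; apply: eq_bigr => x _; apply: eq_bigr => y _.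
  by rewrite sym.
have -> : 2 * (d%:R - s * t) * S =
    d%:R * S + d%:R * S - s * (t * S) - s * (t * S) by ring.
rewrite -{1}S1 -S2 -{1}S3 -S4 !mulr_sumr -!sumrN -!big_split /=.
apply: eq_bigr => x _; rewrite !mulr_sumr -!sumrN -!big_split /=.
apply: eq_bigr => y _; rewrite !normCK rmorphB rmorphM /= (CrealP sr).
have -> : (v x - s * v y) * ((v x)^* - s * (v y)^*) =
  v x * (v x)^* + s ^+ 2 * (v y * (v y)^*) - s * (v x * (v y)^*) - s * (v y * (v x)^*).
  by ring.
by rewrite s2; ring.
Qed.

Lemma sum_norm_sq_gt0 (T : finType) (v : T -> algC) x :
  v x != 0 -> 0 < \sum_y `|v y| ^+ 2.
Proof.
move=> vx; rewrite (bigD1 x) //= ltr_wpDr //; last by rewrite exprn_gt0 ?normr_gt0.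
by apply: sumr_ge0 => y _; rewrite exprn_ge0.
Qed.

Lemma adj_eigenvalue_bound (T : finType) (e : rel T) d (v : T -> algC) (t s : algC) x :
  symmetric e -> regular e d -> s \is Num.real -> s ^+ 2 = 1 ->
  (forall y, \sum_x v x * (e x y)%:R = t * v y) -> v x != 0 -> s * t <= d%:R.
Proof.
move=> sym reg sr s2 ev vx; have D := dirichlet_form sym reg sr s2 ev.
have : 0 <= 2 * (d%:R - s * t) * \sum_x `|v x| ^+ 2.
  rewrite -D; apply: sumr_ge0 => z _; apply: sumr_ge0 => y _.
  by rewrite mulr_ge0 ?exprn_ge0 ?ler0n.
rewrite pmulr_lge0 ?(sum_norm_sq_gt0 vx) // pmulr_rge0 ?ltr0n //.
by rewrite subr_ge0.
Qed.

(** For [t = d] and [s = 1] the Dirichlet form vanishes, so [v] agrees across every edge and then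
    along every path. *)
Lemma adj_top_eigenvector_constant (T : finType) (e : rel T) d (v : T -> algC) :
  symmetric e -> connected_graph e -> regular e d ->
  (forall y, \sum_x v x * (e x y)%:R = d%:R * v y) -> forall x y, v x = v y.
Proof.
move=> sym con reg ev.
have := dirichlet_form sym reg (real1 _) (expr1n _ 2) ev.
rewrite mul1r subrr mulr0 mul0r => D.
have adjv x y : e x y -> v x = v y.
  move=> exy; have ge0 (i j : T) : 0 <= (e i j)%:R * `|v i - 1 * v j| ^+ 2.
    by rewrite mulr_ge0 ?exprn_ge0 ?ler0n.
  have /psumr_eq0P/(_ x isT) := D; move=> /(_ (fun i _ => sumr_ge0 _ (fun j _ => ge0 i j))).
  move/psumr_eq0P => /(_ (fun j _ => ge0 x j) y isT) /eqP.
  by rewrite exy !mul1r expf_eq0 /= normr_eq0 subr_eq0 => /eqP.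
move=> x y; have /connectP [p pth ->] := con x y.
by elim: p x pth => //= z p IH x /andP [/adjv -> /IH].
Qed.

Lemma adj_spectrum (T : finType) (e : rel T) d :
  simple_graph e -> connected_graph e -> regular e d -> (0 < #|T|)%N ->
  exists U l, [/\ diagonalizes (adj e) U l,
    forall i, - d%:R <= l 0 i <= d%:R &
    exists2 i0, l 0 i0 = d%:R & forall i, i != i0 -> l 0 i < d%:R].
Proof.
move=> [sym _] con reg T0.
have symA i j : adj e i j = adj e j i by rewrite !mxE sym.
have realA i j : adj e i j \is Num.real by rewrite mxE realn.
have [U [l [dA lr]]] := symmetric_real_diagonalizes symA realA.
have uU := dA.1.
pose v i x := U i (enum_rank x).
have ev i y : \sum_x v i x * (e x y)%:R = l 0 i * v i y.
  rewrite -(diagonalizes_row i _ dA) -sum_enum_val; apply: eq_bigr => k _.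
  by rewrite /v mxE enum_valK enum_rankK.
(* A zero row would contradict the invertibility of [U]. *)
have vn0 i : exists x, v i x != 0.
  apply/existsP; apply: contraT; rewrite negb_exists => /forallP h.
  have : delta_mx 0 i *m U = 0 :> 'rV_#|T|.
    apply/matrixP => j k; rewrite -rowE !mxE; apply/eqP.
    by have := h (enum_val k); rewrite negbK /v enum_valK.
  move/(congr1 (mulmx^~ (invmx U))); rewrite mulmxK // mul0mx => /matrixP/(_ 0 i).
  by rewrite !mxE !eqxx => /eqP; rewrite oner_eq0.
have bound i : - d%:R <= l 0 i <= d%:R.
  have [x vx] := vn0 i; apply/andP; split; last first.
    by rewrite -[l 0 i]mul1r (adj_eigenvalue_bound sym reg (real1 _) (expr1n _ 2) (ev i) vx).
  have rN : -1 \is @Num.real algC by rewrite realN real1.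
  have sN : (-1) ^+ 2 = 1 :> algC by rewrite sqrrN expr1n.
  by have := adj_eigenvalue_bound sym reg rN sN (ev i) vx; rewrite mulN1r lerNl.
exists U, l; split=> //.
have [i0 li0] : exists i0, l 0 i0 = d%:R.
  (* Coordinates of the all-ones vector, an eigenvector for [d], in the eigenbasis: any nonzero
     coordinate sits at an eigenvalue [d]. *)
  pose w : 'rV_#|T| := const_mx 1 *m invmx U.
  have wD : w *m diag_mx l = d%:R *: w.
    have oneA : const_mx 1 *m adj e = d%:R *: const_mx 1 :> 'rV_#|T|.
      apply/matrixP => i j; rewrite !mxE mulr1 -(reg (enum_val j)) -sum_adj_row.
      rewrite -(sum_enum_val (fun y => (e (enum_val j) y)%:R)).
      by apply: eq_bigr => k _; rewrite !mxE mul1r sym.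
    by rewrite /w scalemxAl -oneA dA.2 !mulmxA mulmxK.
  have /existsP [i wi] : [exists i, w 0 i != 0].
    apply: contraT; rewrite negb_exists => /forallP h.
    have : w = 0.
      apply/matrixP => i j; rewrite ord1 [RHS]mxE; apply/eqP.
      by have := h j; rewrite negbK.
    move/(congr1 (mulmx^~ U)); rewrite /w mulmxKV // mul0mx.
    move/matrixP/(_ 0 (Ordinal T0)); rewrite !mxE => /eqP.
    by rewrite oner_eq0.
  exists i; apply: (mulfI wi); have /matrixP/(_ 0 i) := wD.
  by rewrite mul_mx_diag !mxE => ->; rewrite mulrC.
exists i0 => // i ni; have /andP [_ le] := bound i; rewrite lt_neqAle le andbT.
apply/eqP => lid.
have ci := adj_top_eigenvector_constant sym con reg
  (fun y => etrans (ev i y) (congr1 (fun z => z * v i y) lid)).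
have c0 := adj_top_eigenvector_constant sym con reg
  (fun y => etrans (ev i0 y) (congr1 (fun z => z * v i0 y) li0)).
have [x vx] := vn0 i0.
(* Two constant rows are proportional, which gives a linear relation between rows of the invertible
   [U]; its coefficient [v i0 x] is not zero. *)
have : (v i0 x *: delta_mx 0 i - v i x *: delta_mx 0 i0) *m U = 0 :> 'rV_#|T|.
  apply/matrixP => j k; rewrite mulmxBl -!scalemxAl -!rowE !mxE.
  have := ci x (enum_val k); have := c0 x (enum_val k); rewrite /v enum_valK => -> ->.
  by rewrite mulrC subrr.
move/(congr1 (mulmx^~ (invmx U))); rewrite mulmxK // mul0mx => /matrixP/(_ 0 i).
by rewrite !mxE !eqxx (negPf ni) /= mulr1 mulr0 subr0 => h; rewrite h eqxx in vx.
Qed.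


(** * Small regular graphs and closed walks *)

Lemma regular_lt_card (T : finType) (e : rel T) d :
  irreflexive e -> regular e d -> (0 < #|T|)%N -> (d < #|T|)%N.
Proof.
move=> irr reg /card_gt0P [x _]; rewrite -(reg x).
by apply: proper_card; apply/properP; split; [exact: subset_predT | exists x; rewrite ?inE ?irr].
Qed.

(** By counting, the [d] neighbours of a vertex are all the other vertices, so any bijection with
    the ordinals is an isomorphism. *)
Lemma regular_complete (T : finType) (e : rel T) d n :
  irreflexive e -> regular e d -> #|T| = n -> n = d.+1 -> graph_iso e (@Kn_rel n).
Proof.
move=> irr reg Tn nd; exists (fun x => cast_ord Tn (enum_rank x)); split.
  exists (fun i => enum_val (cast_ord (esym Tn) i)) => x.
    by rewrite cast_ordK enum_rankK.
  by rewrite enum_valK cast_ordKV.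
move=> x y; rewrite /Kn_rel (inj_eq (@cast_ord_inj _ _ _)) (inj_eq enum_rank_inj).
have [->|nxy] := eqVneq x y; first by rewrite irr.
have E : [set w | e x w] = [set~ x].
  apply/eqP; rewrite eqEcard; apply/andP; split.
    by apply/subsetP => w; rewrite !inE; apply: contraTneq => ->; rewrite irr.
  by rewrite cardsC1 Tn nd /= cardsE -{1}(reg x).
have : y \in [set~ x] by rewrite !inE eq_sym.
by rewrite -E inE => ->.
Qed.

Lemma handshake (T : finType) (e : rel T) d :
  simple_graph e -> regular e d -> ~~ odd (#|T| * d).
Proof.
move=> [sym irr] reg.
(* The enumeration rank orients each edge, so that [S] counts it once. *)
pose S := (\sum_x \sum_y (e x y && (enum_rank x < enum_rank y)%N))%N.
have -> : (#|T| * d = \sum_x \sum_y e x y)%N.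
  rewrite -sum_nat_const; apply: eq_bigr => x _.
  by rewrite -(reg x) /deg -sum1_card big_mkcond.
have -> : (\sum_x \sum_y e x y = S + S)%N.
  have SE : S = (\sum_x \sum_y (e x y && (enum_rank y < enum_rank x)))%N.
    rewrite /S exchange_big; apply: eq_bigr => x _; apply: eq_bigr => y _.
    by rewrite sym.
  rewrite {2}SE -big_split; apply: eq_bigr => x _ /=.
  rewrite -big_split; apply: eq_bigr => y _ /=.
  case: ltngtP => [||/ord_inj/enum_rank_inj ->]; rewrite ?andbT ?andbF ?addn0 ?add0n //.
  by rewrite irr.
by rewrite addnn odd_double.
Qed.

(** Fix [v]. A neighbour of [v] has no neighbour in [N v], so its three neighbours are exactly the
    three vertices outside [N v]. By symmetry each vertex outside [N v] is adjacent to all of [N v],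
    and these two sets are the sides of the bipartition. *)
Lemma trianglefree_cubic_K33 (T : finType) (e : rel T) :
  simple_graph e -> regular e 3 -> #|T| = 6%N ->
  (forall x y z, ~~ [&& e x y, e y z & e z x]) -> graph_iso e K33_rel.
Proof.
move=> [sym irr] reg T6 nt.
have /card_gt0P [v _] : (0 < #|T|)%N by rewrite T6.
pose N x := [set w | e x w].
have cN x : #|N x| = 3%N by rewrite cardsE; apply: reg.
have cNC x : #|~: N x| = 3%N by have := cardsC (N x); rewrite cN T6 => -[].
have N1 a : a \in N v -> N a = ~: N v.
  rewrite inE => eva; apply/eqP; rewrite eqEcard cN cNC leqnn andbT.
  apply/subsetP => w; rewrite !inE => eaw; apply/negP => evw.
  by have := nt v a w; rewrite eva eaw sym evw.
have N2 w : w \notin N v -> N w = N v.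
  move=> wN; apply/eqP; rewrite eq_sym eqEcard !cN leqnn andbT.
  apply/subsetP => a aN; rewrite inE sym.
  by have := N1 a aN => /setP/(_ w); rewrite !inE => ->; rewrite inE in wN.
have eE x y : e x y = ((x \in N v) != (y \in N v)).
  have -> : e x y = (y \in N x) by rewrite inE.
  have [xN|xN] := boolP (x \in N v); first by rewrite (N1 x xN) inE; case: (y \in N v).
  by rewrite (N2 x xN); case: (y \in N v).
pose S (b : bool) := if b then N v else ~: N v.
have cS b : #|S b| = 3%N by rewrite /S; case: b.
have xS x : x \in S (x \in N v).
  by rewrite /S; case: ifP => // h; rewrite inE h.
(* The second coordinate is the position within the side, which is below 3 because both sides have
   three vertices. *)
pose h x : bool * 'I_3 := (x \in N v, inord (index x (enum (S (x \in N v))))).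
exists h; split; last by move=> x y; rewrite eE.
apply: inj_card_bij; last by rewrite card_prod card_bool card_ord T6.
move=> x y [bE] /(congr1 val) /=.
have ix z : (index z (enum (S (z \in N v))) < 3)%N.
  by rewrite -[X in (_ < X)%N](cS (z \in N v)) cardE index_mem mem_enum.
rewrite !inordK // bE => iE.
have xe : x \in enum (S (y \in N v)) by rewrite -bE mem_enum.
have ye : y \in enum (S (y \in N v)) by rewrite mem_enum.
by rewrite -(nth_index x xe) iE nth_index.
Qed.

Lemma adj_mxtrace1 (T : finType) (e : rel T) : irreflexive e -> \tr (adj e) = 0.
Proof. by move=> irr; apply: big1 => i _; rewrite mxE irr. Qed.

Lemma adj_mxtrace2 (T : finType) (e : rel T) d :
  symmetric e -> regular e d -> \tr (adj e *m adj e) = #|T|%:R * d%:R.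
Proof.
move=> sym reg; transitivity (\sum_(i < #|T|) (d%:R : algC)); last first.
  by rewrite sumr_const card_ord mulr_natl.
apply: eq_bigr => i _; rewrite mxE -(reg (enum_val i)) -sum_adj_row.
rewrite -(sum_enum_val (fun y => (e (enum_val i) y)%:R)).
by apply: eq_bigr => j _; rewrite !mxE [e (enum_val j) _]sym; case: (e _ _); rewrite ?mulr1 ?mulr0.
Qed.

(** The trace counts closed walks of length three, and a triangle provides one. *)
Lemma adj_mxtrace3_gt0 (T : finType) (e : rel T) x y z :
  [&& e x y, e y z & e z x] -> 0 < \tr (adj e *m adj e *m adj e).
Proof.
move=> /and3P [exy eyz ezx].
have ge0 i j k : 0 <= adj e i j * adj e j k * adj e k i.
  by rewrite !mxE !mulr_ge0 ?ler0n.
have -> : \tr (adj e *m adj e *m adj e) =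
    \sum_i \sum_k \sum_j adj e i j * adj e j k * adj e k i.
  apply: eq_bigr => i _; rewrite mxE; apply: eq_bigr => k _.
  by rewrite mxE mulr_suml.
rewrite (bigD1 (enum_rank x)) //= ltr_wpDr //.
  by do 3![apply: sumr_ge0 => ? _].
rewrite (bigD1 (enum_rank z)) //= ltr_wpDr //; first by do 2![apply: sumr_ge0 => ? _].
rewrite (bigD1 (enum_rank y)) //= ltr_wpDr //; first by apply: sumr_ge0 => ? _.
by rewrite !mxE !enum_rankK exy eyz ezx !mulr1 ltr01.
Qed.

(** * Lower bounds for the sum of [1 / (d - l_i)] *)

(** The left side is the tangent of [1 / x] at [c]; the gap is [(c - x)^2 / (c^2 x)]. *)
Lemma inv_ge_tangent (c x : algC) : 0 < c -> 0 < x -> 2 / c - x / c ^+ 2 <= x^-1.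
Proof.
move=> c0 x0; rewrite -subr_ge0.
have -> : x^-1 - (2 / c - x / c ^+ 2) = (c - x) ^+ 2 / (c ^+ 2 * x).
  by field; rewrite !gt_eqF.
apply: divr_ge0; last by rewrite mulr_ge0 ?exprn_ge0 ?ltW.
by rewrite real_exprn_even_ge0 // rpredB ?gtr0_real.
Qed.

(* The cubic interpolates 1 / (3 - x) doubly at x = 0 and x = -3, the eigenvalues of K33
   other than 3. *)
Lemma inv_ge_cubic (x : algC) : -3 <= x < 3 ->
  3^-1 + x / 9 + x ^+ 2 / 36 + x ^+ 3 / 324 <= (3 - x)^-1.
Proof.
move=> /andP [x3 xl3]; rewrite -subr_ge0.
have x0 : 0 < 3 - x by rewrite subr_gt0.
have -> : (3 - x)^-1 - (3^-1 + x / 9 + x ^+ 2 / 36 + x ^+ 3 / 324) =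
  (x * (3 + x)) ^+ 2 / (324 * (3 - x)) by field; rewrite gt_eqF.
apply: divr_ge0; last by rewrite mulr_ge0 ?ler0n ?ltW.
have xr : x \is Num.real by rewrite (ler_real (ltW xl3)) realn.
by rewrite real_exprn_even_ge0 // realM ?realD ?realn.
Qed.


Lemma resolvent_trace_convex n d (l : 'rV[algC]_n) i0 :
  (1 < n)%N -> (0 < d)%N -> l 0 i0 = d%:R -> (forall i, i != i0 -> l 0 i < d%:R) ->
  \sum_i l 0 i = 0 ->
  (n%:R - 1) ^+ 2 / (d%:R * n%:R) <= \sum_i (d%:R - l 0 i)^-1.
Proof.
move=> n1 d0 li0 lt tr0.
have d0' : 0 < d%:R :> algC by rewrite ltr0n.
have n0' : 0 < n%:R :> algC by rewrite ltr0n ltnW.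
have n1' : 0 < n%:R - 1 :> algC by rewrite subr_gt0 ltr1n.
(* The mean of [d - l_i] over the [n - 1] indices other than [i0], where the total is [n d] by the
   trace condition. The tangent at the mean gives Jensen's inequality. *)
pose c : algC := d%:R * n%:R / (n%:R - 1).
have c0 : 0 < c by rewrite divr_gt0 ?mulr_gt0.
have -> : \sum_i (d%:R - l 0 i)^-1 = \sum_(i | i != i0) (d%:R - l 0 i)^-1.
  by rewrite (bigD1 i0) //= li0 subrr invr0 add0r.
apply: le_trans (_ : \sum_(i | i != i0) (2 / c - (d%:R - l 0 i) / c ^+ 2) <= _); last first.
  by apply: ler_sum => i ni; apply: inv_ge_tangent; rewrite ?subr_gt0 ?lt.
have suml : \sum_(i | i != i0) (d%:R - l 0 i) = n%:R * d%:R.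
  transitivity (\sum_i (d%:R - l 0 i)).
    by rewrite [RHS](bigD1 i0) //= li0 subrr add0r.
  by rewrite sumrB tr0 subr0 sumr_const card_ord mulr_natl.
rewrite sumrB -[X in _ <= _ - X]mulr_suml suml sumr_const cardC1 card_ord.
have nE : n.-1%:R = n%:R - 1 :> algC by rewrite -subn1 natrB // ltnW.
rewrite -[X in _ <= X - _]mulr_natr nE; rewrite le_eqVlt; apply/orP; left; apply/eqP.
by rewrite /c; field; rewrite !gt_eqF.
Qed.

(** The value 3/2 is attained by K33, whose spectrum is 3, -3 and four zeros. Summing the cubic
    minorant leaves the excess [tr A^3 / 324], which makes the inequality strict. *)
Lemma resolvent_trace_cubic (l : 'rV[algC]_6) i0 :
  l 0 i0 = 3 -> (forall i, i != i0 -> l 0 i < 3) -> (forall i, -3 <= l 0 i) ->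
  \sum_i l 0 i = 0 -> \sum_i l 0 i ^+ 2 = 18 -> 0 < \sum_i l 0 i ^+ 3 ->
  3 / 2 < \sum_i (3 - l 0 i)^-1.
Proof.
move=> li0 lt ge t1 t2 t3.
have split (g : algC -> algC) : \sum_(i | i != i0) g (l 0 i) = \sum_i g (l 0 i) - g 3.
  by rewrite [in RHS](bigD1 i0) //= li0 addrAC subrr add0r.
have -> : \sum_i (3 - l 0 i)^-1 = \sum_(i | i != i0) (3 - l 0 i)^-1.
  by rewrite (bigD1 i0) //= li0 subrr invr0 add0r.
apply: lt_le_trans (_ : \sum_(i | i != i0)
    (3^-1 + l 0 i / 9 + l 0 i ^+ 2 / 36 + l 0 i ^+ 3 / 324) <= _); last first.
  by apply: ler_sum => i ni; apply: inv_ge_cubic; rewrite ge lt.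
(* The cubic takes the value 1 at 3, which is removed for the index [i0]. *)
rewrite (split (fun x => 3^-1 + x / 9 + x ^+ 2 / 36 + x ^+ 3 / 324)).
rewrite !big_split /= -!mulr_suml t1 t2 sumr_const card_ord.
rewrite -subr_gt0.
have -> : 3^-1 *+ 6 + 0 / 9 + 18 / 36 + (\sum_i l 0 i ^+ 3) / 324 -
    (3^-1 + 3 / 9 + 3 ^+ 2 / 36 + 3 ^+ 3 / 324) - 3 / 2 = (\sum_i l 0 i ^+ 3) / 324 :> algC.
  by field.
by rewrite divr_gt0 ?ltr0n.
Qed.

(** The degree is written [d.+3], so that degree minus two is [d.+1] without subtraction. *)
Lemma resolvent_trace_bound_large n d (l : 'rV[algC]_n) i0 :
  (d.+3 < n)%N -> (6 < n)%N || (0 < d)%N && (5 < n)%N ->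
  l 0 i0 = d.+3%:R -> (forall i, i != i0 -> l 0 i < d.+3%:R) -> \sum_i l 0 i = 0 ->
  n%:R / d.+3%:R + d.+1%:R^-1 < 2 * \sum_i (d.+3%:R - l 0 i)^-1.
Proof.
move=> dn big li0 lt tr0.
have n1 : (1 < n)%N by apply: leq_trans dn.
(* The claim after clearing denominators. As [d + 3 <= 3 (d + 1)], it follows from
   [n^2 - 7 n + 2 > 0], true from [n = 7] on. If [d > 0] then [d + 3 <= 2 (d + 1)], and
   [n^2 - 6 n + 2 > 0] already holds at [n = 6]. *)
have nat_ineq : (n * n * d.+1 + n * d.+3 < 2 * (n.-1 * n.-1) * d.+1)%N.
  case/orP: big => [h|/andP[h1 h2]].
    by case: n h {dn l i0 li0 lt tr0 n1} => // n h; rewrite /=; nia.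
  by case: n h2 {dn l i0 li0 lt tr0 n1} => // n h2; case: d h1 => // d _ /=; nia.
have conv := resolvent_trace_convex n1 (ltn0Sn _) li0 lt tr0.
apply: lt_le_trans (_ : 2 * ((n%:R - 1) ^+ 2 / (d.+3%:R * n%:R)) <= _); last first.
  by rewrite ler_pM2l ?ltr0n.
have n0' : 0 < n%:R :> algC by rewrite ltr0n ltnW.
have nE : n.-1%:R = n%:R - 1 :> algC by rewrite -subn1 natrB // ltnW.
have := nat_ineq; rewrite -(ltr_nat algC) !natrD !natrM nE.
rewrite -subr_gt0 => h; rewrite -subr_gt0.
have d3 : 0 < d.+3%:R :> algC by rewrite ltr0n.
have d1 : 0 < d.+1%:R :> algC by rewrite ltr0n.
move: h n0' d3 d1; move: (n%:R) (d.+3%:R) (d.+1%:R) => a b c h a0 b0 c0.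
have -> : 2 * ((a - 1) ^+ 2 / (b * a)) - (a / b + c^-1) =
    (2 * ((a - 1) * (a - 1)) * c - (a * a * c + a * b)) / (b * a * c) :> algC.
  by field; rewrite !gt_eqF.
by rewrite divr_gt0 // !mulr_gt0.
Qed.

(** * The two inequalities for the ratio *)

Theorem theorem3p4 (T : finType) (e : rel T) (d : nat) :
  simple_graph e -> connected_graph e -> regular e d -> (3 <= d)%N -> (0 < #|T|)%N ->
  ~ graph_iso e (@Kn_rel 4) -> ~ graph_iso e (@Kn_rel 5) -> ~ graph_iso e K33_rel ->
  1 - 2 / d%:R < K_nb e / K_e e < (1 : algC).
Proof.
move=> gr con reg d3 T0 nK4 nK5 nK33; have [sym irr] := gr.
have [U [l [dA bnd [i0 li0 lt]]]] := adj_spectrum gr con reg T0.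
have dT := regular_lt_card irr reg T0.
have tr1 : \sum_i l 0 i = 0 by rewrite -(diagonalizes_mxtrace dA) adj_mxtrace1.
have one : \sum_i (l 0 i == d%:R)%:R = 1 :> algC.
  rewrite (bigD1 i0) //= li0 eqxx big1 ?addr0 // => i ni.
  by rewrite (lt_eqF (lt i ni)).
pose S := \sum_i (d%:R - l 0 i)^-1.
have S0 : 0 <= S.
  by apply: sumr_ge0 => i _; rewrite invr_ge0 subr_ge0; case/andP: (bnd i).
have main : #|T|%:R / d%:R + (d%:R - 2)^-1 < 2 * S.
  have [k dk] : exists k, d = k.+3 by exists (d - 3)%N; lia.
  have d2 : d%:R - 2 = k.+1%:R :> algC by rewrite dk -natrB.
  have [big|small] := boolP ((6 < #|T|)%N || (0 < k)%N && (5 < #|T|)%N).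
    rewrite d2 /S; move: dT li0 lt; rewrite dk => dT li0 lt.
    exact: (resolvent_trace_bound_large dT big li0 lt tr1).
  (* What remains is [n = d + 1] with [d] equal to 3 or 4, and [d = 3] with [n] equal to 5 or 6. *)
  have [T4|T4] := eqVneq #|T| d.+1.
    have [d3'|d4] : d = 3%N \/ d = 4%N by lia.
      by case: nK4; apply: (regular_complete irr reg); rewrite ?T4 d3'.
    by case: nK5; apply: (regular_complete irr reg); rewrite ?T4 d4.
  have d3' : d = 3%N by lia.
  have T5 : #|T| <> 5%N by move=> T5; have := handshake gr reg; rewrite T5 d3'.
  have T6 : #|T| = 6%N by lia.
  have [/existsP[x /existsP[y /existsP[z tri]]]|notri] :=
      boolP [exists x, exists y, exists z, [&& e x y, e y z & e z x]]; last first.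
    have reg3 : regular e 3 by move: reg; rewrite d3'.
    case: nK33; apply: (trianglefree_cubic_K33 gr reg3 T6).
    move=> x y z; apply: contra notri => h.
    by apply/existsP; exists x; apply/existsP; exists y; apply/existsP; exists z.
  have dA2 := diagonalizes_mulmx dA dA.
  have dA3 := diagonalizes_mulmx dA2 dA.
  have tr2 : \sum_i l 0 i ^+ 2 = 18.
    transitivity (\tr (adj e *m adj e)); last by rewrite (adj_mxtrace2 sym reg) T6 d3'; ring.
    by rewrite (diagonalizes_mxtrace dA2); apply: eq_bigr => i _; rewrite mxE.
  have tr3 : 0 < \sum_i l 0 i ^+ 3.
    suff -> : \sum_i l 0 i ^+ 3 = \tr (adj e *m adj e *m adj e).
      exact: adj_mxtrace3_gt0 tri.
    by rewrite (diagonalizes_mxtrace dA3); apply: eq_bigr => i _; rewrite !mxE; ring.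
  have bnd' i : - d%:R <= l 0 i by case/andP: (bnd i).
  rewrite T6 /S; move: l i0 li0 lt tr1 tr2 tr3 bnd' {bnd dA one S S0 dA2 dA3 U}.
  rewrite d3' T6 => l i0 li0 lt tr1 tr2 tr3 bnd'.
  (* For [n = 6] and [d = 3] the bound to beat is [6 / 3 + 1 = 2 (3 / 2)]. *)
  have := resolvent_trace_cubic li0 lt bnd' tr1 tr2 tr3.
  rewrite -(ltr_pM2l (_ : 0 < 2 :> algC)) ?ltr0n //.
  by congr (_ < _); field.
have dn : 0 < d%:R :> algC by rewrite ltr0n; lia.
have d2n : 0 < d%:R - 2 :> algC by rewrite subr_gt0 (ltr_nat _ 2 d).
have nn : 0 < #|T|%:R :> algC by rewrite ltr0n.
have d1n : 0 < d%:R - 1 :> algC by rewrite subr_gt0 ltr1n; lia.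
have Ke := K_e_regular reg (ltn_trans (ltn0Sn 1) d3) dA.
have Kn := K_nb_regular gr reg d3 dA.
rewrite one mul1r in Kn; rewrite -/S in Ke Kn.
have Ke0 : 0 < K_e e by rewrite Ke ltr_wpDr ?mulr_gt0 ?mulr_ge0 // ltW.
rewrite ltr_pdivlMr // ltr_pdivrMr // mul1r -subr_gt0 -[X in _ && X]subr_gt0 Ke Kn.
apply/andP; split.
  (* The terms in [S] cancel, and what is left is visibly positive. *)
  have -> : #|T|%:R * ((d%:R - 1) ^+ 2 / d%:R + 1) + (d%:R - 2) * S + (d%:R - 2)^-1 -
     (1 - 2 / d%:R) * (#|T|%:R * (d%:R - 1) + d%:R * S) =
     #|T|%:R * ((d%:R - 1) / d%:R + 1) + (d%:R - 2)^-1 by field; rewrite ?gt_eqF.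
  by rewrite addr_gt0 ?invr_gt0 // mulr_gt0 // addr_gt0 ?divr_gt0.
(* The coefficient of [S] is [d - (d - 2) = 2] and that of [n] is [- 1 / d], so positivity is
   exactly [main]. *)
have -> : #|T|%:R * (d%:R - 1) + d%:R * S -
  (#|T|%:R * ((d%:R - 1) ^+ 2 / d%:R + 1) + (d%:R - 2) * S + (d%:R - 2)^-1) =
  2 * S - (#|T|%:R / d%:R + (d%:R - 2)^-1) by field; rewrite ?gt_eqF.
by rewrite subr_gt0.
Qed.
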